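(* Consider the MPC closed loop with zone control and input targets (described in the context), with any input horizon $m$. Assume that the spectral radius of $F$ is strictly smaller than $1$, and that the input target $u_{des}$ is such that $u_{des}\in\mathbb{U}$ and $D_0u_{des}\in\mathbb{Y}$. Then the controller is stable, that is, for any $\eta>0$ there exists $\varepsilon>0$ such that $\|u_{des}\|\le\varepsilon$ implies $$\left\|\begin{bmatrix} y^*(0|k)-y^*_{sp,k}\\ u^*(0|k)-u_{des}\end{bmatrix}\right\|\le\eta\quad\text{for all }k\ge 1 .$$ (Here all data of the controller other than $u_{des}$ are fixed, and $\varepsilon$ does not depend on $u_{des}$.)
   Context: $\|\cdot\|$ is the Euclidean norm. Model. Let $F\in\mathbb{C}^{n_d\times n_d}$, $D_0\in\mathbb{R}^{n_y\times n_u}$, $D_d\in\mathbb{C}^{n_d\times n_u}$, $\Psi\in\mathbb{R}^{n_y\times n_d}$. For discrete times $k\ge 0$ the system has static state $x_s\in\mathbb{R}^{n_y}$, dynamic state $x_d\in\mathbb{C}^{n_d}$, input $u\in\mathbb{R}^{n_u}$ and (real) output $y\in\mathbb{R}^{n_y}$, with $$x_s(k+1)=x_s(k)+D_0(u(k+1)-u(k)),\quad x_d(k+1)=Fx_d(k)+D_d(u(k+1)-u(k)),\quad y(k)=x_s(k)+\Psi x_d(k).$$ At time $0$: $u(0)=0$, $x_s(0)=0$, $x_d(0)=0$. Predictions. Let $m\ge 1$ be an integer (input horizon). At each time step $k\ge 1$, a sequence of moves $\Delta u_k=(\Delta u(0|k),\dots,\Delta u(m-1|k))\in(\mathbb{R}^{n_u})^m$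 is considered, with $\Delta u(j|k)=0$ for $j\ge m$. Starting from the actual values $u(k-1)$, $x_s(k-1)$, $x_d(k-1)$ (assigned to index $j=-1$), the predictions for $j\ge 0$ are $$x_s(j|k)=x_s(j-1|k)+D_0\Delta u(j|k),\quad x_d(j|k)=Fx_d(j-1|k)+D_d\Delta u(j|k),\quad y(j|k)=x_s(j|k)+\Psi x_d(j|k),$$ and $u(j|k)=u(k-1)+\sum_{i=0}^{j}\Delta u(i|k)$. Optimization problem. Let $u_{des}\in\mathbb{R}^{n_u}$ be the input target. The output set-point $y_{sp,k}\in\mathbb{R}^{n_y}$ and the slack vectors $\delta_{y,k}\in\mathbb{R}^{n_y}$, $\delta_{u,k}\in\mathbb{R}^{n_u}$ are decision variables. Let $Q_y,S_y\in\mathbb{R}^{n_y\times n_y}$ and $Q_u,R,S_u\in\mathbb{R}^{n_u\times n_u}$ be positive definite, and write $\|v\|_M^2=v^TMv$. The cost is $$V_k=\sum_{j=0}^{\infty}\|y(j|k)-y_{sp,k}-\delta_{y,k}\|_{Q_y}^2+\sum_{j=0}^{\infty}\|u(j|k)-u_{des}-\delta_{u,k}\|_{Q_u}^2+\sum_{j=0}^{m-1}\|\Delta u(j|k)\|_R^2+\|\delta_{y,k}\|_{S_y}^2+\|\delta_{u,k}\|_{S_u}^2 .$$ At each $k\ge 1$, $V_k$ is minimized over $(\Delta u_k,y_{sp,k},\delta_{y,k},\delta_{u,k})$ subject to $x_s(m-1|k)-y_{sp,k}-\delta_{y,k}=0$, $u(m-1|k)-u_{des}-\delta_{u,k}=0$,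 $u(k-1)+\sum_{j=0}^{i}\Delta u(j|k)\in\mathbb{U}$ for $0\le i<m$, $\Delta u(j|k)\in\Delta\mathbb{U}$ for $0\le j<m$, and $y_{sp,k}\in\mathbb{Y}$, where $\mathbb{U},\Delta\mathbb{U}$ are fixed rectangles in $\mathbb{R}^{n_u}$ and $\mathbb{Y}$ is a fixed rectangle in $\mathbb{R}^{n_y}$, each containing the corresponding origin. The solution is unique; it is denoted $\Delta u_k^*,y_{sp,k}^*,\delta_{y,k}^*,\delta_{u,k}^*$, the corresponding optimal cost is $V_k^*$, and starred quantities $u^*,x_s^*,x_d^*,y^*$ are the ones obtained from it. Closed loop. Only the first move is implemented: the actual input, state and output at time $k$ are $u(k)=u^*(0|k)=\sum_{\ell=1}^{k}\Delta u^*(0|\ell)$, $x_s(k)=x_s^*(0|k)$, $x_d(k)=x_d^*(0|k)$, $y(k)=y^*(0|k)$, and the problem is then solved again at time $k+1$. *)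

(* Defs.v *)
From HB Require Import structures.
From mathcomp Require Import all_boot all_order all_algebra complex.
From mathcomp Require Import all_classical all_reals all_analysis.
Set Implicit Arguments.
Unset Strict Implicit.
Unset Printing Implicit Defensive.
Import Order.TTheory GRing.Theory Num.Theory.
Local Open Scope classical_set_scope.
Local Open Scope ring_scope.

(* The library norm on matrices is the maximum norm. *)
Definition enorm (R : realType) n (v : 'cV[R]_n) : R :=
  Num.sqrt (\sum_(i < n) v i 0 ^+ 2).

Definition wnorm2 (R : realType) n (M : 'M[R]_n) (v : 'cV[R]_n) : R :=
  (v^T *m M *m v) 0 0.

(* Symmetry of M is not required: only the quadratic form of M is used, so
   this covers both usual conventions. *)
Definition posdefmx (R : realType) n (M : 'M[R]_n) : Prop :=
  forall v : 'cV[R]_n, v != 0 -> 0 < wnorm2 M v.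

(* The spectrum is finite, so this supremum is a maximum; it is 0 if n = 0. *)
Definition spectral_radius (R : realType) n (A : 'M[R[i]]_n) : R :=
  sup [set Normc.normc a | a in [set a | eigenvalue A a]].

(* A product of intervals; the sides may be bounded or not, and may or may
   not contain their endpoints. *)
Definition is_rectangle (R : realType) n (A : set 'cV[R]_n) : Prop :=
  exists I : 'I_n -> interval R, A = [set v | forall i, v i 0 \in I i].

Definition mx_to_C (R : realType) p q (A : 'M[R]_(p, q)) : 'M[R[i]]_(p, q) :=
  map_mx (real_complex R) A.

Record mpc (R : realType) (nd ny nu : nat) := Mpc {
  sysF : 'M[R[i]]_nd;
  sysD0 : 'M[R]_(ny, nu);
  sysDd : 'M[R[i]]_(nd, nu);
  sysPsi : 'M[R]_(ny, nd);
  wQy : 'M[R]_ny;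
  wQu : 'M[R]_nu;
  wR : 'M[R]_nu;
  wSy : 'M[R]_ny;
  wSu : 'M[R]_nu;
  boxU : set 'cV[R]_nu;
  boxDU : set 'cV[R]_nu;
  boxY : set 'cV[R]_ny }.

(* st_u is the input applied last. *)
Record state (R : realType) (nd ny nu : nat) := State {
  st_u : 'cV[R]_nu;
  st_s : 'cV[R]_ny;
  st_d : 'cV[R[i]]_nd }.

Record decision (R : realType) (ny nu m : nat) := Decision {
  moves : 'I_m -> 'cV[R]_nu;
  ysp : 'cV[R]_ny;
  dy : 'cV[R]_ny;
  du : 'cV[R]_nu }.

Section Mpc.
Variables (R : realType) (nd ny nu m : nat) (c : mpc R nd ny nu).
Implicit Types (x : state R nd ny nu) (d : decision R ny nu m).

(* v is the input increment u(k+1) - u(k). *)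
Definition step x (v : 'cV[R]_nu) : state R nd ny nu :=
  State (st_u x + v)
        (st_s x + sysD0 c *m v)
        (sysF c *m st_d x + sysDd c *m mx_to_C v).

Fixpoint run x (v : nat -> 'cV[R]_nu) (k : nat) : state R nd ny nu :=
  if k is k'.+1 then step (run x v k') (v k') else x.

Definition state0 : state R nd ny nu := State 0 0 0.

Definition dyn_output x : 'cV[R[i]]_ny := mx_to_C (sysPsi c) *m st_d x.

(* Along the trajectories of the system Psi x_d is real (see
   real_valued_output), so taking the real part loses nothing. *)
Definition output x : 'cV[R]_ny :=
  st_s x + map_mx (@complex.Re R) (dyn_output x).

(* As u(0) = 0, arbitrary inputs u(1), u(2), ... amount to arbitrary
   increments v. *)
Definition real_valued_output : Prop :=
  forall (v : nat -> 'cV[R]_nu) (k : nat),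
    map_mx (@complex.Im R) (dyn_output (run state0 v k)) = 0.

Definition move d (j : nat) : 'cV[R]_nu :=
  if insub j is Some i then moves d i else 0.

(* The measured state x carries the prediction index -1, hence the shift. *)
Definition predict x d (j : nat) : state R nd ny nu := run x (move d) j.+1.

Variable udes : 'cV[R]_nu.

(* The two infinite sums may a priori diverge, so the cost is extended real. *)
Definition cost x d : \bar R :=
  (\sum_(0 <= j <oo) (wnorm2 (wQy c) (output (predict x d j) - ysp d - dy d))%:E
   + \sum_(0 <= j <oo) (wnorm2 (wQu c) (st_u (predict x d j) - udes - du d))%:E
   + (\sum_(j < m) wnorm2 (wR c) (moves d j)
      + wnorm2 (wSy c) (dy d) + wnorm2 (wSu c) (du d))%:E)%E.

Definition feasible x d : Prop :=
  [/\ st_s (predict x d m.-1) - ysp d - dy d = 0,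
      st_u (predict x d m.-1) - udes - du d = 0,
      (forall i : 'I_m, boxU c (st_u x + \sum_(j < i.+1) move d j)),
      (forall j : 'I_m, boxDU c (moves d j)) &
      boxY c (ysp d)].

Definition optimal x d : Prop :=
  feasible x d /\ forall d', feasible x d' -> (cost x d <= cost x d')%E.

(* sol k is the solution computed at time k >= 1; sol 0 is not used. *)
Definition loop_state (sol : nat -> decision R ny nu m) (k : nat) :
    state R nd ny nu :=
  run state0 (fun l => move (sol l.+1) 0) k.

Definition closed_loop (sol : nat -> decision R ny nu m) : Prop :=
  forall k, (1 <= k)%N -> optimal (loop_state sol k.-1) (sol k).

End Mpc.

(* Main.v *)
Require Import Defs.
From mathcomp Require Import all_boot all_order all_algebra complex.
From mathcomp Require Import all_classical all_reals all_analysis.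
From mathcomp Require Import ring lra.
Import Order.TTheory GRing.Theory Num.Theory.
Local Open Scope ring_scope.

(** The optimal cost is a Lyapunov function for the closed loop, and the whole
    proof rests on two comparisons with explicit feasible candidates.

    At time 1 the plant is at the origin, so making no move, with set-point 0,
    output slack 0 and input slack [- udes], is feasible; it costs only
    [wnorm2 (wSu c) udes] ([cost_rest]).  At every later time, the tail of the
    previous optimal plan followed by a zero move, with the same set-point and
    slacks, is feasible and its predictions are those of the previous plan
    delayed by one step ([predict_shift], [feasible_shift]).  Its cost is thus
    the previous optimal cost minus the nonnegative terms of index 0
    ([cost_shift]).  By induction every optimal cost is at most
    [wnorm2 (wSu c) udes], which is quadratically small in [udes]
    ([closed_loop_cost]).

    All the terms of the cost being nonnegative, this bounds the weighted norms
    of [y(0|k) - ysp - dy], [dy], [u(0|k) - udes - du] and [du] separately.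
    Positive definite forms dominate the Euclidean norm
    ([posdefmx_coercive]), and adding the slack back to each residual yields
    the two blocks of the vector to be estimated. *)

(** * Quadratic forms *)

Section QuadraticForms.
Set Implicit Arguments.
Context {R : realType}.

Definition sqnorm n (v : 'cV[R]_n) : R := \sum_(i < n) v i 0 ^+ 2.

Lemma sqnorm_ge0 n (v : 'cV[R]_n) : 0 <= sqnorm v.
Proof. by apply: sumr_ge0 => i _; exact: sqr_ge0. Qed.

Lemma enorm_leP n (v : 'cV[R]_n) (e : R) : 0 <= e ->
  (enorm v <= e) = (sqnorm v <= e ^+ 2).
Proof.
move=> e0; rewrite -[e in LHS]ger0_norm// -sqrtr_sqr.
by rewrite ler_sqrt// sqr_ge0.
Qed.

Lemma sqnorm_col_mx p q (a : 'cV[R]_p) (b : 'cV[R]_q) :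
  sqnorm (col_mx a b) = sqnorm a + sqnorm b.
Proof.
rewrite /sqnorm big_split_ord /=; congr (_ + _).
  by apply: eq_bigr => i _; rewrite col_mxEu.
by apply: eq_bigr => i _; rewrite col_mxEd.
Qed.

Lemma sqnormD n (a b : 'cV[R]_n) :
  sqnorm (a + b) <= 2 * (sqnorm a + sqnorm b).
Proof.
rewrite /sqnorm -big_split mulr_sumr; apply: ler_sum => i _ /=.
by rewrite mxE; have := sqr_ge0 (a i 0 - b i 0); nra.
Qed.

Lemma wnorm2_0 n (M : 'M[R]_n) : wnorm2 M 0 = 0.
Proof. by rewrite /wnorm2 mulmx0 mxE. Qed.

Lemma wnorm2N n (M : 'M[R]_n) v : wnorm2 M (- v) = wnorm2 M v.
Proof. by rewrite /wnorm2 [(- v)^T]linearN /= !mulNmx mulmxN opprK. Qed.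

Lemma posdefmx_ge0 n (M : 'M[R]_n) v : posdefmx M -> 0 <= wnorm2 M v.
Proof.
move=> hM; have [->|v0] := eqVneq v 0; first by rewrite wnorm2_0.
exact/ltW/hM.
Qed.

Lemma tr00 (A : 'M[R]_1) : A 0 0 = A^T 0 0.
Proof. by rewrite mxE. Qed.

Lemma wnorm2_trmx n (M : 'M[R]_n) v : wnorm2 M^T v = wnorm2 M v.
Proof.
by rewrite /wnorm2 tr00 !trmx_mul !trmxK mulmxA.
Qed.

Lemma wnorm2_sym n (M : 'M[R]_n) v : wnorm2 (M + M^T) v = 2 * wnorm2 M v.
Proof.
by rewrite mulr_natl mulr2n -{2}(wnorm2_trmx M) /wnorm2 mulmxDr mulmxDl mxE.
Qed.

(** A vector in the kernel of [M + M^T] annihilates the quadratic form of [M],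
    since [M] and [M + M^T] have the same form up to a factor 2. *)
Lemma posdefmx_sym_unit n (M : 'M[R]_n) :
  posdefmx M -> M + M^T \in unitmx.
Proof.
move=> hM; rewrite -row_free_unit; apply: inj_row_free => v vS0.
apply/trmx_inj/eqP; rewrite trmx0; apply: contraT => /hM.
have := wnorm2_sym M v^T.
rewrite {1}/wnorm2 trmxK vS0 mul0mx mxE => E.
by rewrite ltNge; lra.
Qed.

Lemma wnorm2_line n (M : 'M[R]_n) (v w : 'cV[R]_n) (t : R) :
  wnorm2 M (v - t *: w) =
  wnorm2 M v - t * (v^T *m (M + M^T) *m w) 0 0 + t ^+ 2 * wnorm2 M w.
Proof.
have sw : (w^T *m M *m v) 0 0 = (v^T *m M^T *m w) 0 0.
  by rewrite [RHS]tr00 !trmx_mul !trmxK mulmxA.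
rewrite /wnorm2 [(v - _)^T]linearB [X in _ - X]linearZ /=.
rewrite !(mulmxDr, mulmxDl, mulmxN, mulNmx) -!scalemxAr -!scalemxAl.
have addE (A B : 'M[R]_1) : (A + B) 0 0 = A 0 0 + B 0 0 by rewrite mxE.
have oppE (A : 'M[R]_1) : (- A) 0 0 = - A 0 0 by rewrite mxE.
have scaleE (s : R) (A : 'M[R]_1) : (s *: A) 0 0 = s * A 0 0 by rewrite mxE.
rewrite !(addE, oppE, scaleE) sw; ring.
Qed.

(** Compactness of the sphere is avoided: with [w] the solution of
    [(M + M^T) w = e_i], the cross term of [wnorm2 M (v - t w)] is [t] times
    the coordinate [v_i], so that nonnegativity of this quadratic polynomial
    in [t] bounds [v_i ^+ 2] by a multiple of [wnorm2 M v].  Symmetrizing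
    makes this work when [M] itself is not symmetric. *)
Lemma posdefmx_coercive n (M : 'M[R]_n) : posdefmx M ->
  exists2 K : R, 0 <= K & forall v, sqnorm v <= K * wnorm2 M v.
Proof.
move=> hM; have uS := posdefmx_sym_unit hM.
pose w i : 'cV[R]_n := invmx (M + M^T) *m delta_mx i 0.
have Sw i : (M + M^T) *m w i = delta_mx i 0 by rewrite mulKVmx.
have w_gt0 i : 0 < wnorm2 M (w i).
  apply: hM; apply/negP => /eqP w0; move: (Sw i).
  rewrite w0 mulmx0 => /matrixP /(_ i 0).
  by rewrite !mxE !eqxx => /eqP; rewrite eq_sym oner_eq0.
exists (\sum_i 4 * wnorm2 M (w i)).
  by apply: sumr_ge0 => i _; rewrite mulr_ge0// ltW.
move=> v; rewrite mulr_suml; apply: ler_sum => i _.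
(* the minimizer of the polynomial in t *)
pose t := v i 0 / (2 * wnorm2 M (w i)).
have := posdefmx_ge0 (v - t *: w i) hM.
rewrite wnorm2_line -mulmxA Sw -colE !mxE.
have -> : v i 0 = t * (2 * wnorm2 M (w i)).
  by rewrite /t divfK// gt_eqF// mulr_gt0.
by move: (w_gt0 i); nra.
Qed.

Lemma wnorm2_le_sqnorm n (M : 'M[R]_n) :
  exists2 C : R, 0 <= C & forall v, wnorm2 M v <= C * sqnorm v.
Proof.
exists (\sum_i \sum_j `|M j i|).
  by apply: sumr_ge0 => i _; apply: sumr_ge0.
have le_sq (v : 'cV[R]_n) i : `|v i 0| ^+ 2 <= sqnorm v :> R.
  rewrite real_normK ?num_real// /sqnorm (bigD1 i)//= lerDl.
  by apply: sumr_ge0 => j _; exact: sqr_ge0.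
move=> v; rewrite /wnorm2 mxE mulr_suml; apply: ler_sum => i _.
rewrite mxE !mulr_suml; apply: ler_sum => j _; rewrite mxE.
apply: le_trans (ler_norm _) _; rewrite !normrM.
have := le_sq v i; have := le_sq v j.
move: (normr_ge0 (M j i)) (sqr_ge0 (`|v i 0| - `|v j 0|)).
set a := `|v j 0|; set b := `|v i 0|; set p := `|M j i|; set s := sqnorm v.
move=> p0 ab ha hb; rewrite mulrAC mulrC.
by apply: ler_wpM2l => //; nra.
Qed.

End QuadraticForms.

(** * The two feasible candidates *)

Section ClosedLoop.
Set Implicit Arguments.
Context {R : realType} {nd ny nu m : nat} (c : mpc R nd ny nu).
Implicit Types (x : state R nd ny nu) (d : decision R ny nu m).

Lemma run_ext x v v' k : v =1 v' -> run c x v k = run c x v' k.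
Proof. by move=> vv'; elim: k => [//|k IH]; exact: f_equal2 IH (vv' k). Qed.

Lemma runSl x v k :
  run c x v k.+1 = run c (step c x (v 0)) (fun j => v j.+1) k.
Proof. by elim: k => [//|k IH]; exact: f_equal2 IH erefl. Qed.

Lemma st_u_run x v k : st_u (run c x v k) = st_u x + \sum_(j < k) v j.
Proof.
elim: k => [|k IH] /=; first by rewrite big_ord0 addr0.
by rewrite IH big_ord_recr addrA.
Qed.

Lemma move_ge d j : (m <= j)%N -> move d j = 0.
Proof. by rewrite leqNgt /move => jm; rewrite insubN. Qed.

Lemma move_ord d (i : 'I_m) : move d i = moves d i.
Proof. by rewrite /move valK. Qed.

(** [move d] vanishes beyond the horizon, so reading it one index later also
    supplies the zero move that completes the tail of the plan. *)
Definition shift d : decision R ny nu m :=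
  Decision (fun i : 'I_m => move d i.+1) (ysp d) (dy d) (du d).

Lemma move_shift d j : move (shift d) j = move d j.+1.
Proof.
have [jm|mj] := ltnP j m; first exact: move_ord _ (Ordinal jm).
by rewrite !move_ge// ltnW.
Qed.

Lemma predict_shift x d j :
  predict c (predict c x d 0) (shift d) j = predict c x d j.+1.
Proof.
rewrite /predict [RHS]runSl; apply: run_ext => i; exact: move_shift.
Qed.

Lemma predict_horizon x d : (0 < m)%N ->
  st_u (predict c x d m) = st_u (predict c x d m.-1) /\
  st_s (predict c x d m) = st_s (predict c x d m.-1).
Proof.
move=> m0; have -> : predict c x d m = step c (predict c x d m.-1) (move d m).
  by rewrite /predict prednK.
by rewrite move_ge//= mulmx0 !addr0.
Qed.

Lemma feasible_shift udes x d : (0 < m)%N -> boxDU c 0 ->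
  feasible c udes x d -> feasible c udes (predict c x d 0) (shift d).
Proof.
move=> m0 DU0 [hs hu hU hDU hY].
have [eu es] := predict_horizon x d m0.
have E := predict_shift x d m.-1; rewrite (prednK m0) in E.
split.
- by rewrite E es; exact: hs.
- by rewrite E eu; exact: hu.
- move=> i /=.
  have -> : st_u x + move d 0 + \sum_(j < i.+1) move (shift d) j
      = st_u x + \sum_(j < i.+2) move d j.
    rewrite [in RHS]big_ord_recl addrA; congr (_ + _).
    by apply: eq_bigr => j _; rewrite move_shift.
  have [im|mi] := ltnP i.+1 m; first exact: hU (Ordinal im).
  by rewrite big_ord_recr /= [move d i.+1]move_ge// addr0; exact: hU.
- move=> j /=; have [jm|mj] := ltnP j.+1 m; last by rewrite move_ge.
  by rewrite -[j.+1]/(val (Ordinal jm)) move_ord.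
- exact: hY.
Qed.

Lemma nneseries_shift_le (f : nat -> \bar R) : (forall j, 0 <= f j)%E ->
  (\sum_(0 <= j <oo) f j.+1 <= \sum_(0 <= j <oo) f j)%E.
Proof.
move=> f0; under eq_eseriesr do rewrite -addn1.
by rewrite (nneseries_addn 1)// [leRHS]nneseries_recl// leeDr.
Qed.

Hypothesis hQy : posdefmx (wQy c).
Hypothesis hQu : posdefmx (wQu c).
Hypothesis hR : posdefmx (wR c).
Hypothesis hSy : posdefmx (wSy c).
Hypothesis hSu : posdefmx (wSu c).

(** The index-0 terms dropped by the shift are nonnegative, and the move
    appended at the end of the plan is free. *)
Lemma cost_shift udes x d :
  (cost c udes (predict c x d 0) (shift d) <= cost c udes x d)%E.
Proof.
pose f j := (wnorm2 (wQy c) (output c (predict c x d j) - ysp d - dy d))%:E.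
pose g j := (wnorm2 (wQu c) (st_u (predict c x d j) - udes - du d))%:E.
have /funext := predict_shift x d; move: (predict c x d 0) => y E.
rewrite /cost E; apply: leeD; first apply: leeD.
- by apply: (nneseries_shift_le f) => j; rewrite lee_fin posdefmx_ge0.
- by apply: (nneseries_shift_le g) => j; rewrite lee_fin posdefmx_ge0.
- rewrite lee_fin !lerD2r.
  pose r j := wnorm2 (wR c) (move d j).
  have -> : \sum_(j < m) wnorm2 (wR c) (moves d j) = \sum_(j < m) r j.
    by apply: eq_bigr => j _; rewrite /r move_ord.
  rewrite -[leLHS]/(\sum_(j < m) r j.+1).
  have rm : r m = 0 by rewrite /r move_ge// wnorm2_0.
  have -> : \sum_(j < m) r j = \sum_(j < m.+1) r j.
    by rewrite big_ord_recr /= rm addr0.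
  rewrite big_ord_recl lerDr; exact: posdefmx_ge0.
Qed.

Definition rest udes : decision R ny nu m := Decision (fun=> 0) 0 0 (- udes).

Lemma move_rest udes j : move (rest udes) j = 0.
Proof. by rewrite /move; case: insub. Qed.

Lemma predict_rest udes j :
  predict c (state0 R nd ny nu) (rest udes) j = state0 R nd ny nu.
Proof.
rewrite /predict; elim: {j}j.+1 => //= j ->; rewrite move_rest /step /=.
have -> : mx_to_C (0 : 'cV[R]_nu) = 0 by apply/matrixP => i k; rewrite !mxE.
by rewrite !mulmx0 !addr0.
Qed.

Lemma output_state0 : output c (state0 R nd ny nu) = 0.
Proof.
rewrite /output /dyn_output /= mulmx0 add0r.
by apply/matrixP => i j; rewrite !mxE.
Qed.

Lemma feasible_rest udes : boxU c 0 -> boxDU c 0 -> boxY c 0 ->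
  feasible c udes (state0 R nd ny nu) (rest udes).
Proof.
move=> U0 DU0 Y0; split.
- by rewrite predict_rest !subr0.
- by rewrite predict_rest /= sub0r subrr.
- by move=> i /=; rewrite big1 ?addr0// => j _; rewrite move_rest.
- by [].
- by [].
Qed.

Lemma cost_rest udes :
  cost c udes (state0 R nd ny nu) (rest udes) = (wnorm2 (wSu c) udes)%:E.
Proof.
have /funext E := predict_rest udes; rewrite /cost E.
rewrite eseries0; last first.
  by move=> j _ _; rewrite output_state0 !subr0 wnorm2_0.
rewrite eseries0; last first.
  by move=> j _ _; rewrite /= sub0r subrr wnorm2_0.
by rewrite big1 => [|j _]; rewrite !wnorm2_0// wnorm2N !add0r.
Qed.

(** * Decrease of the optimal cost *)

Lemma closed_loop_cost udes (sol : nat -> decision R ny nu m) k :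
  (0 < m)%N -> boxU c 0 -> boxDU c 0 -> boxY c 0 ->
  closed_loop c udes sol ->
  (cost c udes (loop_state c sol k) (sol k.+1) <= (wnorm2 (wSu c) udes)%:E)%E.
Proof.
move=> m0 U0 DU0 Y0 hsol; elim: k => [|k IH].
  have [_ /(_ (rest udes))] := hsol 1%N isT.
  by rewrite -cost_rest; apply; exact: feasible_rest.
have [_ opt] := hsol k.+2 isT; have [feas _] := hsol k.+1 isT.
apply: le_trans IH.
apply: le_trans (cost_shift udes (loop_state c sol k) (sol k.+1)).
exact/opt/feasible_shift.
Qed.

Lemma cost_le_terms udes x d (B : R) : (cost c udes x d <= B%:E)%E ->
  [/\ wnorm2 (wQy c) (output c (predict c x d 0) - ysp d - dy d) <= B,
      wnorm2 (wQu c) (st_u (predict c x d 0) - udes - du d) <= B,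
      wnorm2 (wSy c) (dy d) <= B & wnorm2 (wSu c) (du d) <= B].
Proof.
pose f j := (wnorm2 (wQy c) (output c (predict c x d j) - ysp d - dy d))%:E.
pose g j := (wnorm2 (wQu c) (st_u (predict c x d j) - udes - du d))%:E.
pose s := \sum_(j < m) wnorm2 (wR c) (moves d j).
have -> : cost c udes x d = (\sum_(0 <= j <oo) f j + \sum_(0 <= j <oo) g j
  + (s + wnorm2 (wSy c) (dy d) + wnorm2 (wSu c) (du d))%:E)%E by [].
have f0 j : (0 <= f j)%E by rewrite lee_fin posdefmx_ge0.
have g0 j : (0 <= g j)%E by rewrite lee_fin posdefmx_ge0.
have s0 : 0 <= s by apply: sumr_ge0 => j _; exact: posdefmx_ge0.
have fle : (f 0%N <= \sum_(0 <= j <oo) f j)%E.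
  by rewrite nneseries_recl// leeDl// nneseries_ge0.
have gle : (g 0%N <= \sum_(0 <= j <oo) g j)%E.
  by rewrite nneseries_recl// leeDl// nneseries_ge0.
move/(le_trans (leeD (leeD fle gle) (lexx _))).
rewrite /f /g -!EFinD lee_fin.
have := posdefmx_ge0 (output c (predict c x d 0) - ysp d - dy d) hQy.
have := posdefmx_ge0 (st_u (predict c x d 0) - udes - du d) hQu.
have := posdefmx_ge0 (dy d) hSy; have := posdefmx_ge0 (du d) hSu.
by move=> *; split; lra.
Qed.

(** * Stability *)

(** The cost controls each residual and its slack, whose sum is the quantity
    to be estimated; the factor 2 in the constant comes from [sqnormD]. *)
Lemma cost_le_sqnorm : exists2 K : R, 0 <= K &
  forall udes x d (B : R), (cost c udes x d <= B%:E)%E ->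
  sqnorm (col_mx (output c (predict c x d 0) - ysp d)
                 (st_u (predict c x d 0) - udes)) <= K * B.
Proof.
have [Ky Ky0 leQy] := posdefmx_coercive hQy.
have [Ku Ku0 leQu] := posdefmx_coercive hQu.
have [Ly Ly0 leSy] := posdefmx_coercive hSy.
have [Lu Lu0 leSu] := posdefmx_coercive hSu.
exists (2 * (Ky + Ly + Ku + Lu)); first lra.
move=> udes x d B /cost_le_terms [hy hu hdy hdu].
set a := output c _ - _ in hy *; set b := st_u _ - _ in hu *.
have ha := sqnormD (a - dy d) (dy d); have hb := sqnormD (b - du d) (du d).
rewrite sqnorm_col_mx; rewrite !subrK in ha hb.
have := ler_wpM2l Ky0 hy; have := ler_wpM2l Ku0 hu.
have := ler_wpM2l Ly0 hdy; have := ler_wpM2l Lu0 hdu.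
have := leQy (a - dy d); have := leQu (b - du d).
by have := leSy (dy d); have := leSu (du d); lra.
Qed.

End ClosedLoop.

Theorem theorem3p4 (R : realType) (nd ny nu m : nat) (c : mpc R nd ny nu)
    (hm : (1 <= m)%N)
    (hreal : real_valued_output c)
    (hQy : posdefmx (wQy c)) (hQu : posdefmx (wQu c)) (hR : posdefmx (wR c))
    (hSy : posdefmx (wSy c)) (hSu : posdefmx (wSu c))
    (hU : is_rectangle (boxU c)) (hU0 : boxU c 0)
    (hDU : is_rectangle (boxDU c)) (hDU0 : boxDU c 0)
    (hY : is_rectangle (boxY c)) (hY0 : boxY c 0)
    (hF : spectral_radius (sysF c) < 1) :
  forall eta : R, 0 < eta ->
  exists2 eps : R, 0 < eps &
    forall udes : 'cV[R]_nu,
      boxU c udes -> boxY c (sysD0 c *m udes) ->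
      forall sol : nat -> decision R ny nu m, closed_loop c udes sol ->
      enorm udes <= eps ->
      forall k : nat, (1 <= k)%N ->
        let x := predict c (loop_state c sol k.-1) (sol k) 0 in
        enorm (col_mx (output c x - ysp (sol k)) (st_u x - udes)) <= eta.
Proof.
move=> eta eta0.
have [K K0 leK] := @cost_le_sqnorm R nd ny nu m c hQy hQu hR hSy hSu.
have [C C0 leC] := wnorm2_le_sqnorm (wSu c).
have KC0 : 0 <= K * C by exact: mulr_ge0.
(* K C eps^2 <= eta^2, without a square root since K C <= (1 + K C)^2 *)
pose eps := eta / (1 + K * C).
have epsE : eta = eps * (1 + K * C) by rewrite /eps divfK// gt_eqF//; lra.
have eps0 : 0 < eps by rewrite divr_gt0//; lra.
exists eps => // udes _ _ sol hsol.
rewrite enorm_leP ?(ltW eps0)// => small [//|k] _; cbv zeta.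
rewrite enorm_leP ?(ltW eta0)//.
have V := closed_loop_cost hQy hQu hR k hm hU0 hDU0 hY0 hsol.
apply: le_trans (leK _ _ _ _ V) _.
apply: le_trans (ler_wpM2l K0 (leC udes)) _; rewrite mulrA.
apply: le_trans (ler_wpM2l KC0 small) _.
have -> : eta ^+ 2 = (1 + K * C) ^+ 2 * eps ^+ 2 by rewrite epsE exprMn mulrC.
apply: ler_wpM2r; first exact: sqr_ge0.
by move: KC0; set p := K * C; nra.
Qed.
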